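(* For every field $K$, the algebra $K[w,x,y,z]/(w^4,x^4,y^4,z^4,\,wxy(w+z))$ has the Weak Lefschetz property if and only if the characteristic of $K$ is not two or five.
   Context: $K[w,x,y,z]$ has the standard grading. A standard graded Artinian $K$-algebra $A$ has the Weak Lefschetz property (WLP) if there is a linear form $L\in A_1$ such that for all integers $j$ the multiplication map $\times L: A_{j-1}\to A_j$ has maximal rank, i.e. is injective or surjective. The field $K$ may be finite or infinite. *)

(* Defs.v *)
From HB Require Import structures.
From mathcomp Require Import all_boot all_order all_algebra ring_quotient.
From mathcomp Require Import boolp classical_sets functions.
From mathcomp.multinomials Require Import mpoly.

Set Implicit Arguments.
Unset Strict Implicit.
Unset Printing Implicit Defensive.

Import GRing.Theory.

Local Open Scope classical_set_scope.
Local Open Scope ring_scope.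
Local Open Scope quotient_scope.

Definition ideal_gen (R : comNzRingType) (s : seq R) : pred R :=
  fun p => `[< exists c : 'I_(size s) -> R, p = \sum_(i < size s) c i * s`_i >].

Lemma ideal_gen_closed (R : comNzRingType) (s : seq R) :
  ~~ ideal_gen s 1 -> idealr_closed (ideal_gen s).
Proof.
move=> s1; split => //.
  by apply/asboolP; exists (fun=> 0); rewrite big1 // => i _; rewrite mul0r.
move=> a u v /asboolP[c ->] /asboolP[d ->].
apply/asboolP; exists (fun i => a * c i + d i).
rewrite mulr_sumr -big_split; apply: eq_bigr => i _ /=.
by rewrite mulrDl mulrA.
Qed.

(* The degree-j part of K[x_1, .., x_n] / I for the standard grading; it is a
   grading when I is homogeneous.  Pieces of negative degree are 0. *)
Definition graded_piece (K : fieldType) (n : nat) (I : idealr {mpoly K[n]})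
    (j : int) : set {ideal_quot I} :=
  match j with
  | Posz d => \pi_({ideal_quot I}) @` [set p | p \is d.-homog]
  | Negz _ => [set 0]
  end.

Arguments graded_piece {K n} I j _.

Definition weak_lefschetz (K : fieldType) (n : nat) (I : idealr {mpoly K[n]}) :
    Prop :=
  exists2 L : {ideal_quot I}, graded_piece I 1 L &
    forall j : int,
      set_inj (graded_piece I (j - 1)) ( *%R L) \/
      set_surj (graded_piece I (j - 1)) (graded_piece I j) ( *%R L).

Definition J_gens (K : fieldType) : seq {mpoly K[4]} :=
  let w := 'X_0 in let x := 'X_1 in let y := 'X_2 in let z := 'X_3 in
  [:: w ^+ 4; x ^+ 4; y ^+ 4; z ^+ 4; w * x * y * (w + z)].

Arguments J_gens K : clear implicits.

Definition J (K : fieldType) : pred {mpoly K[4]} := ideal_gen (J_gens K).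

Arguments J K : clear implicits.

Lemma J_idealr_closed (K : fieldType) : idealr_closed (J K).
Proof.
apply/ideal_gen_closed/negP => /asboolP[c /(congr1 (meval (fun=> 0)))].
rewrite rmorph1 rmorph_sum big1 => [/eqP|i _]; first by rewrite oner_eq0.
rewrite rmorphM /=; suff -> : ((J_gens K)`_i).@[fun=> 0] = 0 by rewrite mulr0.
case: i => -[|[|[|[|[|]]]]] //= _;
  by rewrite ?rmorphXn ?rmorphM /= ?rmorphM /= !mevalXU ?expr0n ?mul0r.
Qed.

HB.instance Definition _ (K : fieldType) :=
  isIdealr.Build {mpoly K[4]} (J K) (J_idealr_closed K).

(* Main.v *)
From HB Require Import structures.
Require Import Defs.
From mathcomp Require Import all_boot all_order all_algebra ring_quotient.
From mathcomp Require Import boolp classical_sets functions.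
From mathcomp.multinomials Require Import mpoly.
From mathcomp Require Import ring zify.

(* In characteristic 2 or 5 every linear form l satisfies l^5 = 0 in A.  Take k
   minimal with l^k = 0: then l^(k-1) kills injectivity of A_(k-1) -> A_k, and
   surjectivity would give A_9 = l^(10-k) A_(k-1) = 0 although x^3y^3z^3 <> 0.

   Otherwise L = w + x + y - z is a Lefschetz element.  Put s = w + x + y, so that
   A/(L) = K[w,x,y]/(w^4, x^4, y^4, s^4, wxy(w+s)).  This ring vanishes in degree 6,
   hence L is surjective onto A_j for j >= 6.  For p of degree at most 4, a relation
   L p = sum c_i g_i has cofactors of degree at most 1; it becomes a syzygy of the
   five quartics modulo L, and these have no syzygy of degree at most 1, so L
   divides every c_i and p lies in the ideal. *)

Set Implicit Arguments.
Unset Strict Implicit.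
Unset Printing Implicit Defensive.

Import GRing.Theory.

Local Open Scope classical_set_scope.
Local Open Scope ring_scope.
Local Open Scope quotient_scope.

(** * The weak Lefschetz property in terms of homogeneous polynomials *)

Lemma pi_ideal_eq0 (R : comNzRingType) (I : idealr R) (p : R) :
  (\pi_({ideal_quot I}) p == 0) = (p \in I).
Proof. by rewrite -(rmorph0 \pi_({ideal_quot I})) -Quotient.idealrBE subr0. Qed.

Lemma pi_ideal_eq (R : comNzRingType) (I : idealr R) (p q : R) :
  (\pi_({ideal_quot I}) p == \pi_({ideal_quot I}) q) = (p - q \in I).
Proof. by rewrite -subr_eq0 -rmorphB pi_ideal_eq0. Qed.

(** For [j <= 0] the source piece is zero and the map is injective, so only [j = d + 1] with [d]
    natural carries a condition. By additivity injectivity is a statement about the kernel, and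
    classes are replaced by homogeneous representatives. *)
Lemma weak_lefschetzP (K : fieldType) (n : nat) (I : idealr {mpoly K[n]}) :
  weak_lefschetz I <->
  exists2 l : {mpoly K[n]}, l \is 1.-homog & forall d : nat,
    (forall p, p \is d.-homog -> l * p \in I -> p \in I) \/
    (forall p, p \is d.+1.-homog -> exists2 q, q \is d.-homog & p - l * q \in I).
Proof.
have posS (d : nat) : d.+1%:Z - 1 = d%:Z by lia.
split=> [[_ [l l1 <-] wlp]|[l l1 wlp]].
  exists l => // d; have := wlp d.+1%:Z; rewrite posS => -[linj|lsurj]; [left|right].
    move=> p pd /=; rewrite -pi_ideal_eq0 rmorphM => /eqP lp0.
    rewrite -pi_ideal_eq0; apply/eqP/linj; last by rewrite mulr0.
      by rewrite inE; exists p.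
    by rewrite inE; exists 0; rewrite ?rmorph0 //= rpred0.
  move=> p pd; have [_ [q qd <-] /eqP] : ( *%R (\pi_({ideal_quot I}) l) @`
    graded_piece I d) (\pi_({ideal_quot I}) p) by apply: lsurj; exists p.
  by rewrite -rmorphM eq_sym pi_ideal_eq; exists q.
exists (\pi_({ideal_quot I}) l); first by exists l.
case=> [[|d]|d]; [by left=> x y; rewrite !inE => -> -> | |
  by left=> x y; rewrite !inE => -> ->].
rewrite posS; case: (wlp d) => [linj|lsurj]; [left|right].
  move=> x y; rewrite !inE => -[p pd <-] [q qd <-] /eqP.
  rewrite -!rmorphM pi_ideal_eq -mulrBr => /linj pq; apply/eqP.
  by rewrite pi_ideal_eq; apply: pq; apply: rpredB.
move=> _ [p /lsurj[q qd pq] <-]; exists (\pi_({ideal_quot I}) q); first by exists q.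
by apply/eqP; rewrite -rmorphM eq_sym pi_ideal_eq.
Qed.

(** * Homogeneous components and coefficients of products *)

Lemma pihomogM (K : comNzRingType) (n d e : nat) (q g : {mpoly K[n]}) :
  g \is e.-homog ->
  pihomog mdeg d (q * g) = if (e <= d)%N then pihomog mdeg (d - e) q * g else 0.
Proof.
(* The range of degrees has to cover all of [q] and also contain the index [d - e], whence the
   maximum. *)
move=> ge; rewrite {1}(@pihomog_partitionE _ _ mdeg (maxn d.+1 (msize q)) q) ?leq_maxr //.
rewrite mulr_suml raddf_sum /=.
have qg i : pihomog mdeg i q * g \is (i + e)%N.-homog by rewrite dhomogM ?pihomogP.
case: leqP => [ed|de]; last first.
  by rewrite big1 // => i _; apply: pihomog_ne0 (qg i); lia.
have lt_de : (d - e < maxn d.+1 (msize q))%N by lia.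
rewrite (bigD1 (Ordinal lt_de)) //= pihomog_dE ?big1 ?addr0 // => [i|].
  rewrite -val_eqE /= => ne; apply: pihomog_ne0 (qg i); lia.
by have := qg (d - e)%N; rewrite subnK.
Qed.

Lemma homogXU (K : fieldType) (n : nat) (i : 'I_n) : ('X_i : {mpoly K[n]}) \is 1.-homog.
Proof. by rewrite dhomogX; apply/eqP; exact: mdeg1. Qed.

(** Explicit exponents let the shift rules below evaluate a coefficient by plain reduction. *)
Definition mn4 (a b c d : nat) : 'X_{1..4} := [multinom [tuple a; b; c; d]].

Lemma mcoeff_XM (K : comNzRingType) (n : nat) (i : 'I_n) (p : {mpoly K[n]}) (m : 'X_{1..n}) :
  ('X_i * p)@_m = if (0 < m i)%N then p@_(m - U_(i)) else 0.
Proof.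
rewrite mulrC; case: ltnP => mi.
  by rewrite -{1}(@submK _ U_(i) m) ?lep1mP -?lt0n // addmC mcoeffMX.
apply: memN_msupp_eq0; rewrite (perm_mem (msuppMX p _)).
apply/mapP => -[m' _ mE]; move: mi.
by rewrite mE mnmDE mnm1E eqxx.
Qed.

Lemma mcoeff_X0M (K : comNzRingType) (p : {mpoly K[4]}) (a b c d : nat) :
  ('X_0 * p)@_(mn4 a b c d) = if a is a'.+1 then p@_(mn4 a' b c d) else 0.
Proof.
rewrite mcoeff_XM multinomE (tnth_nth 0%N) /=; case: a => //= a'; congr (_@__).
by apply/mnmP => -[[|[|[|[|//]]]] ilt];
  rewrite mnmBE mnm1E !multinomE !(tnth_nth 0%N) /= ?subn0 ?subn1.
Qed.

Lemma mcoeff_X1M (K : comNzRingType) (p : {mpoly K[4]}) (a b c d : nat) :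
  ('X_1 * p)@_(mn4 a b c d) = if b is b'.+1 then p@_(mn4 a b' c d) else 0.
Proof.
rewrite mcoeff_XM multinomE (tnth_nth 0%N) /=; case: b => //= b'; congr (_@__).
by apply/mnmP => -[[|[|[|[|//]]]] ilt];
  rewrite mnmBE mnm1E !multinomE !(tnth_nth 0%N) /= ?subn0 ?subn1.
Qed.

Lemma mcoeff_X2M (K : comNzRingType) (p : {mpoly K[4]}) (a b c d : nat) :
  ('X_2 * p)@_(mn4 a b c d) = if c is c'.+1 then p@_(mn4 a b c' d) else 0.
Proof.
rewrite mcoeff_XM multinomE (tnth_nth 0%N) /=; case: c => //= c'; congr (_@__).
by apply/mnmP => -[[|[|[|[|//]]]] ilt];
  rewrite mnmBE mnm1E !multinomE !(tnth_nth 0%N) /= ?subn0 ?subn1.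
Qed.

Lemma mcoeff_X3M (K : comNzRingType) (p : {mpoly K[4]}) (a b c d : nat) :
  ('X_3 * p)@_(mn4 a b c d) = if d is d'.+1 then p@_(mn4 a b c d') else 0.
Proof.
rewrite mcoeff_XM multinomE (tnth_nth 0%N) /=; case: d => //= d'; congr (_@__).
by apply/mnmP => -[[|[|[|[|//]]]] ilt];
  rewrite mnmBE mnm1E !multinomE !(tnth_nth 0%N) /= ?subn0 ?subn1.
Qed.

Definition mcoeff_X4M := (mcoeff_X0M, mcoeff_X1M, mcoeff_X2M, mcoeff_X3M).

(** * Membership in [J] and its homogeneity *)

Lemma ideal_genP (R : comNzRingType) (s : seq R) (p : R) :
  reflect (exists c : 'I_(size s) -> R, p = \sum_(i < size s) c i * s`_i) (p \in ideal_gen s).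
Proof. exact: asboolP. Qed.

Lemma mem_JP (K : fieldType) (p : {mpoly K[4]}) :
  reflect (exists c : 'I_5 -> {mpoly K[4]}, p = \sum_(i < 5) c i * (J_gens K)`_i)
    (p \in J K).
Proof. exact: (ideal_genP (J_gens K) p). Qed.

Lemma J_gens_mem (K : fieldType) (i : nat) : (i < 5)%N -> (J_gens K)`_i \in J K.
Proof.
move=> i5; apply/mem_JP; exists (fun j => (j == Ordinal i5)%:R).
rewrite (bigD1 (Ordinal i5)) //= eqxx mul1r big1 ?addr0 // => j /negPf ->.
by rewrite mul0r.
Qed.

Lemma J_gens_homog (K : fieldType) (i : 'I_5) : (J_gens K)`_i \is 4.-homog.
Proof.
have X1 := @homogXU K 4.
case: i => -[|[|[|[|[|//]]]]] _ /=; try exact: (@dhomogMn _ _ _ 1 _ 4).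
apply: (@dhomogM _ _ _ 3 _ 1); last exact: dhomogD.
by apply: (@dhomogM _ _ _ 2 _ 1) => //; apply: (@dhomogM _ _ _ 1 _ 1).
Qed.

(** All five generators have degree 4, so the cofactors may be cut down to their parts of degree
    [d - 4]; the test guards against truncated subtraction. *)
Lemma pihomog_J_gens (K : fieldType) (d : nat) (c : 'I_5 -> {mpoly K[4]}) :
  pihomog mdeg d (\sum_(i < 5) c i * (J_gens K)`_i) =
  \sum_(i < 5) (if (4 <= d)%N then pihomog mdeg (d - 4) (c i) else 0) * (J_gens K)`_i.
Proof.
rewrite raddf_sum; apply: eq_bigr => i _ /=; rewrite (pihomogM _ _ (J_gens_homog K i)).
by case: ifP; rewrite ?mul0r.
Qed.

Lemma pihomog_J (K : fieldType) (d : nat) (p : {mpoly K[4]}) :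
  p \in J K -> pihomog mdeg d p \in J K.
Proof. by case/mem_JP => c ->; rewrite pihomog_J_gens; apply/mem_JP; eexists. Qed.

(** Every term of a generator is divisible by [w] or by the fourth power of a variable, and this
    monomial by none of these. *)
Lemma x3y3z3_notin_J (K : fieldType) : 'X_[mn4 0 3 3 3] \notin J K.
Proof.
apply/negP => /mem_JP[c /(congr1 (mcoeff (mn4 0 3 3 3))) /eqP].
rewrite mcoeffX eqxx raddf_sum big1 => [|i _]; first by rewrite oner_eq0.
rewrite mulrC; case: i => -[|[|[|[|[|//]]]]] ilt;
  by rewrite /= ?exprS -!mulrA !mcoeff_X4M.
Qed.

(** * Failure in characteristics two and five *)

Lemma not_weak_lefschetz_J (K : fieldType) :
  (forall l : {mpoly K[4]}, l \is 1.-homog -> l ^+ 5 \in J K) ->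
  ~ weak_lefschetz (J K).
Proof.
move=> l5 /weak_lefschetzP[l l1 wlp].
have exk : exists k, l ^+ k \in J K by exists 5; exact: l5.
case: (ex_minnP exk) => k lk kmin; have k5 := kmin _ (l5 l l1).
(* From here on the minimal exponent is [k.+1]; exponent 0 would put 1 in [J]. *)
case: k lk kmin k5 => [|k] lk kmin k5; first by rewrite idealr1 in lk.
have homog_lk e : l ^+ e \is e.-homog by have := dhomogMn e l1; rewrite mul1n.
case: (wlp k) => [linj|lsurj].
  by move: (linj _ (homog_lk k)); rewrite -exprS => /(_ lk) /kmin; rewrite ltnn.
(* Surjectivity in one degree propagates upwards because the algebra is generated in degree one: a
   variable is split off the monomial, induction treats the rest, and ['X_i * r] is again a multiple
   of [l] modulo [J]. *)
have lpow n m : mdeg m = (k.+1 + n)%N ->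
    exists2 q, q \is k.-homog & 'X_[m] - l ^+ n.+1 * q \in J K.
  elim: n m => [|n IHn] m mE.
    by rewrite expr1; apply: lsurj; rewrite dhomogX -[X in _ == X]addn0; apply/eqP.
  have [i mi] : exists i, (0 < m i)%N.
    apply/existsP; apply: contraT => /existsPn m0.
    have : mdeg m == 0%N.
      by rewrite mdeg_eq0; apply/eqP/mnmP => i; rewrite mnm0E; have := m0 i; lia.
    by rewrite mE addnS.
  have mDi : m = (U_(i) + (m - U_(i)))%MM by rewrite addmC submK // lep1mP -lt0n.
  have [|r rk rE] := IHn (m - U_(i))%MM.
    by move: mE; rewrite {1}mDi mdegD mdeg1; lia.
  have [|q qk qE] := lsurj ('X_i * r); first 
    by apply: (@dhomogM _ _ _ 1) => //; exact: homogXU.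
  exists q => //; rewrite mDi mpolyXD.
  have -> : 'X_i * 'X_[m - U_(i)] - l ^+ n.+2 * q =
      'X_i * ('X_[m - U_(i)] - l ^+ n.+1 * r) + l ^+ n.+1 * ('X_i * r - l * q).
    by rewrite [l ^+ n.+2]exprSr; ring.
  by apply: rpredD; apply: idealMr.
have [|q _] := lpow (9 - k.+1)%N (mn4 0 3 3 3).
  by rewrite mdegE !big_ord_recl big_ord0 !multinomE !(tnth_nth 0%N) /=; lia.
(* Since [k <= 4], the exponent of [l] is at least 5, so the multiple of [l] lies in [J], and with
   it the monomial. *)
have -> : ((9 - k.+1).+1 = (4 - k) + 5)%N by lia.
have lqJ : l ^+ (4 - k + 5) * q \in J K by rewrite exprD mulrAC idealMr ?l5.
by move/(rpredD lqJ); rewrite addrC subrK => xJ; have := x3y3z3_notin_J K; rewrite xJ.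
Qed.

Lemma homog1E (K : fieldType) (n : nat) (l : {mpoly K[n]}) :
  l \is 1.-homog -> l = \sum_(i < n) l@_U_(i) *: 'X_i.
Proof.
move=> l1; apply/mpolyP => m; rewrite raddf_sum /=.
under eq_bigr => i _ do rewrite mcoeffZ mcoeffX.
have [/eqP/mdeg1P[j /eqP ->]|m1] := eqVneq (mdeg m) 1%N.
  rewrite (bigD1 j) //= eqxx mulr1 big1 ?addr0 // => i ij.
  by rewrite eq_mnm1 (negPf ij) mulr0.
rewrite (dhomog_nemf_coeff l1 m1) big1 // => i _.
by case: eqP => [im|_]; [rewrite -im mdeg1 in m1 | rewrite mulr0].
Qed.

Lemma X4_in_J (K : fieldType) (i : 'I_4) : 'X_i ^+ 4 \in J K.
Proof.
suff -> : 'X_i ^+ 4 = (J_gens K)`_i by apply: J_gens_mem; case: i => i /= /ltnW.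
by case: i => -[|[|[|[|//]]]] ilt; congr ('X__ ^+ 4); apply: val_inj.
Qed.

(** The hypotheses make [q] a power of the characteristic, so taking [q]-th powers is additive and
    [l ^+ q] is a combination of the ['X_i ^+ q], each a multiple of ['X_i ^+ 4]. *)
Lemma homog1_pchar_pow_in_J (K : fieldType) (q : nat) (l : {mpoly K[4]}) :
  [pchar K].-nat q -> (4 <= q)%N -> l \is 1.-homog -> l ^+ q \in J K.
Proof.
move=> qchar q4 /homog1E ->; have qchar' : [pchar {mpoly K[4]}].-nat q.
  by apply: sub_in_pnat qchar => p _; apply: (rmorph_pchar (@mpolyC 4 K)).
have powD : {morph (fun r : {mpoly K[4]} => r ^+ q) : r s / r + s}.
  by move=> r s; apply: exprDn_pchar.
have pow0 : (0 : {mpoly K[4]}) ^+ q = 0 by rewrite expr0n; case: q q4 {qchar qchar' powD}.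
rewrite (big_morph _ powD pow0).
apply: rpred_sum => i _; rewrite -mul_mpolyC exprMn; apply: idealMr.
by rewrite -(subnK q4) exprD; apply: idealMr (X4_in_J _ _).
Qed.

Lemma weak_lefschetz_J_pchar (K : fieldType) :
  weak_lefschetz (J K) -> 2%N \notin [pchar K] /\ 5%N \notin [pchar K].
Proof.
move=> wlp; split; apply/negP => charK; apply: not_weak_lefschetz_J wlp => l l1.
  (* In characteristic 2 already the fourth power lies in [J]; in characteristic 5 the fifth power
     is the Frobenius itself. *)
  rewrite exprS idealMr // homog1_pchar_pow_in_J //.
  by rewrite (eq_pnat _ (pcharf_eq charK)).
by rewrite homog1_pchar_pow_in_J // (eq_pnat _ (pcharf_eq charK)).
Qed.

(** * Surjectivity onto degrees at least six *)

(** With [z] eliminated, the last generator is [w * x * y * (2 * w + x + y)]. The factor 40 clears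
    the denominators of all the certificates, so the identities are integral and hold over any
    commutative ring. *)
Lemma degree6_vanish (R : comNzRingType) (w x y : R) (a b c : nat) :
    w ^+ 4 = 0 -> x ^+ 4 = 0 -> y ^+ 4 = 0 ->
    (w + x + y) ^+ 4 = 0 -> w * x * y * (2 * w + x + y) = 0 ->
  (a + b + c)%N = 6 -> 40 * (w ^+ a * x ^+ b * y ^+ c) = 0.
Proof.
move=> w4 x4 y4 s4 f0.
(* The multipliers below solve the linear system for the coefficients of the two
   quadrics [u] and [v], modulo [w^4], [x^4] and [y^4]. *)
have cert u v m : m = u * (w + x + y) ^+ 4 + v * (w * x * y * (2 * w + x + y)) -> m = 0.
  by move=> ->; rewrite s4 f0 !mulr0 addr0.
have big (r : R) n : r ^+ 4 = 0 -> (4 <= n)%N -> r ^+ n = 0.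
  by move=> r4 /subnK <-; rewrite exprD r4 mulr0.
have [/(big w) -> //|a4] := leqP 4 a; first by rewrite !mul0r mulr0.
have [/(big x) -> //|b4] := leqP 4 b; first by rewrite mulr0 mul0r mulr0.
have [/(big y) -> //|c4] := leqP 4 c; first by rewrite !mulr0.
(* Ten monomials of degree 6 have all exponents at most 3; they come in lexicographic order of
   [(a, b, c)]. *)
case: a a4 => [|[|[|[|//]]]] _; case: b b4 => [|[|[|[|//]]]] _;
  case: c c4 => [|[|[|[|//]]]] _ // _.
- apply: (cert (4 * (w ^+ 2 - x ^+ 2 - y ^+ 2 + 3 * (x * y)))
    (- 20 * (4 * w ^+ 2 + x ^+ 2 + y ^+ 2 + 3 * (x * y)))).
  by ring: w4 x4 y4.
- apply: (cert (4 * (- 3 * w ^+ 2 + 3 * y ^+ 2 - 2 * (x * y) + 2 * (w * x)))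
    (40 * (2 * w ^+ 2 - y ^+ 2))).
  by ring: w4 x4 y4.
- apply: (cert (4 * (- 3 * w ^+ 2 + 3 * x ^+ 2 - 2 * (x * y) + 2 * (w * y)))
    (40 * (2 * w ^+ 2 - x ^+ 2))).
  by ring: w4 x4 y4.
- apply: (cert (2 * (3 * w ^+ 2 - 3 * y ^+ 2 + 2 * (x * y) - 2 * (w * x)))
    (40 * (y ^+ 2 - w ^+ 2))).
  by ring: w4 x4 y4.
- apply: (cert (4 * (- 3 * w ^+ 2 + 2 * (w * x) + 2 * (w * y)))
    (- 40 * (x ^+ 2 + x * y + y ^+ 2))).
  by ring: w4 x4 y4.
- apply: (cert (2 * (3 * w ^+ 2 - 3 * x ^+ 2 + 2 * (x * y) - 2 * (w * y)))
    (40 * (x ^+ 2 - w ^+ 2))).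
  by ring: w4 x4 y4.
- apply: (cert (8 * y ^+ 2 - 10 * (x * y) + 7 * x ^+ 2 + 2 * (w * y) - 4 * (w * x) - w ^+ 2)
    (20 * (- y ^+ 2 + x * y + w * x + w ^+ 2))).
  by ring: w4 x4 y4.
- apply: (cert (3 * y ^+ 2 - 2 * (x * y) - 4 * (w * y) - 2 * (w * x) + 3 * w ^+ 2)
    (20 * (x * y + x ^+ 2 + w * y + w ^+ 2))).
  by ring: w4 x4 y4.
- apply: (cert (- 3 * y ^+ 2 + 2 * (x * y) + 4 * (w * y) + 2 * (w * x) - 3 * w ^+ 2)
    (20 * (- (x * y) - x ^+ 2 - w * y + w ^+ 2))).
  by ring: w4 x4 y4.
- apply: (cert (7 * y ^+ 2 - 10 * (x * y) + 8 * x ^+ 2 - 4 * (w * y) + 2 * (w * x) - w ^+ 2)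
    (20 * (- x ^+ 2 + x * y + w * y + w ^+ 2))).
  by ring: w4 x4 y4.
Qed.

(** The powers of [w + x + y], the image of [z], are expanded one factor at a time; each remaining
    monomial has a divisor of degree exactly 6, and [u] inverts 40. *)
Lemma degree_ge6_vanish (R : comNzRingType) (w x y u : R) (a b c d : nat) :
    w ^+ 4 = 0 -> x ^+ 4 = 0 -> y ^+ 4 = 0 ->
    (w + x + y) ^+ 4 = 0 -> w * x * y * (2 * w + x + y) = 0 ->
  u * 40 = 1 -> (6 <= a + b + c + d)%N -> w ^+ a * x ^+ b * y ^+ c * (w + x + y) ^+ d = 0.
Proof.
move=> w4 x4 y4 s4 f0 u40; elim: d a b c => [|d IHd] a b c deg.
  rewrite addn0 in deg; rewrite mulr1 -[LHS]mul1r -u40 -mulrA.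
  have [a' [b' [c' [aa bb cc abc]]]] : exists a' b' c' : nat,
      [/\ a' <= a, b' <= b, c' <= c & a' + b' + c' = 6]%N.
    (* Greedy choice: as much as possible from [a], then from [b], the rest from [c]. *)
    exists (minn a 6), (minn b (6 - minn a 6)), (6 - minn a 6 - minn b (6 - minn a 6))%N.
    by split; lia.
  rewrite -(subnK aa) -(subnK bb) -(subnK cc) !exprD.
  transitivity (u * (w ^+ (a - a') * x ^+ (b - b') * y ^+ (c - c')) *
    (40 * (w ^+ a' * x ^+ b' * y ^+ c'))); first by ring.
  by rewrite degree6_vanish ?mulr0.
transitivity (w ^+ a.+1 * x ^+ b * y ^+ c * (w + x + y) ^+ d +
  w ^+ a * x ^+ b.+1 * y ^+ c * (w + x + y) ^+ d +
  w ^+ a * x ^+ b * y ^+ c.+1 * (w + x + y) ^+ d); first by rewrite !exprS; ring.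
by rewrite !IHd ?addr0 //; lia.
Qed.

Definition lefschetz_form (K : fieldType) : {mpoly K[4]} := 'X_0 + 'X_1 + 'X_2 - 'X_3.

Arguments lefschetz_form K : clear implicits.

Lemma lefschetz_form_homog (K : fieldType) : lefschetz_form K \is 1.-homog.
Proof. by rewrite rpredB ?rpredD ?homogXU. Qed.

(** The ideal defining [A/(L)], whose degree [j] part is the cokernel of multiplication by [L] into
    [A_j]. *)
Definition JL (K : fieldType) : pred {mpoly K[4]} :=
  ideal_gen (lefschetz_form K :: J_gens K).

Arguments JL K : clear implicits.

Lemma mem_JLP (K : fieldType) (p : {mpoly K[4]}) :
  reflect (exists q, p - lefschetz_form K * q \in J K) (p \in JL K).
Proof.
apply: (iffP (ideal_genP (lefschetz_form K :: J_gens K) p)) => [[c ->]|[q /mem_JP[c cE]]].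
  exists (c ord0); rewrite big_ord_recl /= mulrC [X in X - _]addrC addrK.
  by apply/mem_JP; exists (fun i => c (lift ord0 i)).
exists (fun i => if unlift ord0 i is Some j then c j else q).
rewrite big_ord_recl /= unlift_none mulrC; apply/(canRL (subrKC _)).
by rewrite cE; apply: eq_bigr => i _; rewrite liftK.
Qed.

Lemma JL_idealr_closed (K : fieldType) : idealr_closed (JL K).
Proof.
apply/ideal_gen_closed/negP => /asboolP[c /(congr1 (meval (fun=> 0)))].
rewrite rmorph1 rmorph_sum big1 => [/eqP|i _]; first by rewrite oner_eq0.
rewrite rmorphM /=; suff -> : ((lefschetz_form K :: J_gens K)`_i).@[fun=> 0] = 0.
  by rewrite mulr0.
case: i => -[|[|[|[|[|[|]]]]]] //= _;
  rewrite ?rmorphXn ?rmorphB ?rmorphM /= ?rmorphM ?rmorphD /=;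
  by rewrite ?rmorphD /= !mevalXU ?expr0n ?mul0r ?subr0 ?addr0.
Qed.

HB.instance Definition _ (K : fieldType) :=
  isIdealr.Build {mpoly K[4]} (JL K) (JL_idealr_closed K).

Lemma J_sub_JL (K : fieldType) (p : {mpoly K[4]}) : p \in J K -> p \in JL K.
Proof. by move=> pJ; apply/mem_JLP; exists 0; rewrite mulr0 subr0. Qed.

Lemma ord4_sum (T : nmodType) (F : 'I_4 -> T) : \sum_i F i = F 0 + F 1 + F 2 + F 3.
Proof.
rewrite !big_ord_recr big_ord0 /= add0r.
by congr (F _ + F _ + F _ + F _); apply: val_inj.
Qed.

Lemma mpolyX4E (K : comNzRingType) (m : 'X_{1..4}) :
  'X_[m] = 'X_0 ^+ m 0 * 'X_1 ^+ m 1 * 'X_2 ^+ m 2 * 'X_3 ^+ m 3 :> {mpoly K[4]}.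
Proof.
rewrite mpolyXE_id !big_ord_recr big_ord0 /= mul1r.
by congr ('X__ ^+ m _ * 'X__ ^+ m _ * 'X__ ^+ m _ * 'X__ ^+ m _); apply: val_inj.
Qed.

Lemma mdeg4E (m : 'X_{1..4}) : mdeg m = (m 0%R + m 1%R + m 2%R + m 3%R)%N.
Proof. by rewrite mdegE; apply: (@ord4_sum nat). Qed.

(** An arbitrary morphism [pi] keeps the computation in a plain commutative ring, where the image of
    [z] is the sum of those of [w], [x], [y], and 40 is invertible because 2 and 5 are. *)
Lemma rmorph_monomial_vanish (K : fieldType) (R : comNzRingType)
    (pi : {rmorphism {mpoly K[4]} -> R}) (m : 'X_{1..4}) :
  2%N \notin [pchar K] -> 5%N \notin [pchar K] ->
  (forall p, p \in JL K -> pi p = 0) -> (6 <= mdeg m)%N -> pi 'X_[m] = 0.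
Proof.
move=> char2 char5 piJL m6.
have piJ p : p \in J K -> pi p = 0 by move/J_sub_JL/piJL.
have z_sum : pi 'X_3 = pi 'X_0 + pi 'X_1 + pi 'X_2.
  apply/eqP; rewrite eq_sym -subr_eq0 -!rmorphD -rmorphB; apply/eqP/piJL/mem_JLP.
  by exists 1; rewrite mulr1 subrr rpred0.
have X4 (i : 'I_4) : pi 'X_i ^+ 4 = 0 by rewrite -rmorphXn piJ ?X4_in_J.
have two0 : (2 : K) != 0 by move: char2; rewrite inE.
have five0 : (5 : K) != 0 by move: char5; rewrite inE.
have unit40 : pi (40^-1)%:MP * 40 = 1.
  have <- : pi 40%:MP = 40 by rewrite mpolyC_nat rmorph_nat.
  rewrite -rmorphM -mpolyCM mulVf ?mpolyC1 ?rmorph1 //.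
  have -> : (40 : K) = 2 * 2 * 2 * 5 by ring.
  exact: mulf_neq0 (mulf_neq0 (mulf_neq0 two0 two0) two0) five0.
rewrite mpolyX4E !rmorphM !rmorphXn z_sum.
apply: (degree_ge6_vanish _ _ _ _ _ unit40); rewrite ?X4 -?mdeg4E //.
- by rewrite -z_sum X4.
- rewrite -(piJ ('X_0 * 'X_1 * 'X_2 * ('X_0 + 'X_3))); last exact: (@J_gens_mem K 4).
  by rewrite !rmorphM rmorphD z_sum; congr (_ * _); ring.
Qed.

Lemma monomial_in_JL (K : fieldType) (m : 'X_{1..4}) :
  2%N \notin [pchar K] -> 5%N \notin [pchar K] -> (6 <= mdeg m)%N -> 'X_[m] \in JL K.
Proof.
move=> char2 char5 m6; pose I : idealr {mpoly K[4]} := JL K.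
suff : \pi_({ideal_quot I}) 'X_[m] == 0 by rewrite pi_ideal_eq0.
apply/eqP/rmorph_monomial_vanish => // p pJL.
by apply/eqP; rewrite pi_ideal_eq0.
Qed.

Lemma lefschetz_form_surj (K : fieldType) (d : nat) (p : {mpoly K[4]}) :
  2%N \notin [pchar K] -> 5%N \notin [pchar K] -> (5 <= d)%N -> p \is d.+1.-homog ->
  exists2 q, q \is d.-homog & p - lefschetz_form K * q \in J K.
Proof.
move=> char2 char5 d5 pd; have /mem_JLP[q pq] : p \in JL K.
  rewrite [p]mpolyE big_seq; apply: rpred_sum => m mp.
  rewrite -mul_mpolyC; apply: idealMr; apply: monomial_in_JL => //.
  by have := dhomog_mf pd mp => /= ->.
(* The quotient [q] need not be homogeneous; as [J] is, its part of degree [d] does as well. *)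
exists (pihomog mdeg d q); first exact: pihomogP.
have := pihomog_J d.+1 pq; rewrite raddfB /= (pihomog_dE pd) mulrC.
by rewrite (pihomogM _ _ (lefschetz_form_homog K)) /= subSS subn0 mulrC.
Qed.

(** * Injectivity out of degrees at most four *)

Lemma homog_le1E (K : fieldType) (n e : nat) (c : {mpoly K[n]}) :
  (e <= 1)%N -> c \is e.-homog ->
  c = (c@_0%MM)%:MP + \sum_(i < n) c@_U_(i) *: 'X_i.
Proof.
case: e => [|[|//]] _ ce.
  rewrite big1 => [|i _]; last by rewrite (dhomog_nemf_coeff ce) ?scale0r //= mdeg1.
  rewrite addr0; apply/mpolyP => m; rewrite mcoeffC.
  case: eqP => [->|/eqP m0]; first by rewrite mulr1.
  by rewrite mulr0 (dhomog_nemf_coeff ce) //= mdeg_eq0.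
rewrite (dhomog_nemf_coeff ce) /= ?mdeg0 // add0r; exact: homog1E.
Qed.

Lemma mn4U :
  [/\ mn4 0 0 0 0 = 0%MM, mn4 1 0 0 0 = U_(0%R)%MM, mn4 0 1 0 0 = U_(1%R)%MM &
      mn4 0 0 1 0 = U_(2%R)%MM].
Proof.
by split; apply/mnmP => -[[|[|[|[|//]]]] ilt]; rewrite ?mnm0E ?mnm1E multinomE (tnth_nth 0%N).
Qed.

(** The relation is read off at monomials of degrees 4 and 5 free of [z], which see only the
    coefficients of the [ri] in degrees 0 and 1. Hence no homogeneity is assumed. *)
Lemma cubic_sum_syzygy (K : fieldType) (r0 r1 r2 r3 r4 : {mpoly K[4]}) :
  (2 : K) != 0 -> (5 : K) != 0 ->
  let w := 'X_0 in let x := 'X_1 in let y := 'X_2 in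
  w ^+ 4 * r0 + x ^+ 4 * r1 + y ^+ 4 * r2 + (w + x + y) ^+ 4 * r3 +
    w * x * y * (w + (w + x + y)) * r4 = 0 ->
  forall m, m \in [:: 0%MM; U_(0%R)%MM; U_(1%R)%MM; U_(2%R)%MM] ->
  [/\ r0@_m = 0, r1@_m = 0, r2@_m = 0, r3@_m = 0 & r4@_m = 0].
Proof.
move=> two0 five0 w x y rel.
have half (t : K) : t *+ 2 = 0 -> t = 0.
  by rewrite -mulr_natl => /eqP; rewrite mulf_eq0 (negPf two0) => /eqP.
have quarter (t : K) : t *+ 4 = 0 -> t = 0 by move=> t4; apply/half/half; rewrite -mulrnA.
have tenth (t : K) : t *+ 10 = 0 -> t = 0.
  rewrite (mulrnA t 2 5) -mulr_natl => /eqP; rewrite mulf_eq0 (negPf five0) => /eqP.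
  exact: half.
have sE (q : {mpoly K[4]}) m : ((w + x + y) * q)@_m = (w * q)@_m + (x * q)@_m + (y * q)@_m.
  by rewrite !mulrDl !mcoeffD.
have fE (q : {mpoly K[4]}) m : ((w + (w + x + y)) * q)@_m = (w * q)@_m + ((w + x + y) * q)@_m.
  by rewrite mulrDl mcoeffD.
(* Powers are written as nested products by linear factors, so that each rewriting round peels one
   factor off. *)
have coef a b c : (w * (w * (w * (w * r0))))@_(mn4 a b c 0) +
    (x * (x * (x * (x * r1))))@_(mn4 a b c 0) + (y * (y * (y * (y * r2))))@_(mn4 a b c 0) +
    ((w + x + y) * ((w + x + y) * ((w + x + y) * ((w + x + y) * r3))))@_(mn4 a b c 0) +
    (w * (x * (y * ((w + (w + x + y)) * r4))))@_(mn4 a b c 0) = 0.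
  by rewrite -!mcoeffD -[RHS](mcoeff0 K (mn4 a b c 0)) -rel; congr (_@__); ring.
pose coefE := (mcoeff_X4M, sE, fE).
(* Monomials divisible by none of [w ^+ 4], [x ^+ 4], [y ^+ 4], [w * x * y] involve [r3] alone. Once
   [r3] is settled, multiples of [w * x * y] without fourth powers give [r4], and the fourth powers
   then give [r0], [r1], [r2]. *)
have a0 : r3@_(mn4 0 0 0 0) = 0.
  apply: quarter; have := coef 3%N 1%N 0%N; do 6!rewrite ?coefE /=.
  by move=> <-; ring.
have [a1 a2] : r3@_(mn4 1 0 0 0) = 0 /\ r3@_(mn4 0 1 0 0) = 0.
  move: (coef 3%N 2%N 0%N) (coef 2%N 3%N 0%N); do 6!rewrite ?coefE /=.
  move: (r3@_(mn4 1 0 0 0)) (r3@_(mn4 0 1 0 0)) => s t e1 e2.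
  have s0 : s = 0.
    (* The two equations are [6 s + 4 t = 0] and [4 s + 6 t = 0]; eliminating [t] leaves [10 s = 0],
       where 5 has to be invertible. *)
    apply: tenth; have := congr2 (fun u v => 3 * u - 2 * v) e1 e2.
    by rewrite !mulr0 subr0 => <-; ring.
  split=> //; apply: quarter; rewrite -[RHS]e1 s0; ring.
have a3 : r3@_(mn4 0 0 1 0) = 0.
  apply: quarter; have := coef 3%N 0%N 2%N; do 6!rewrite ?coefE /=.
  by rewrite a1 => <-; ring.
have red3 := (a0, a1, a2, a3, add0r, addr0).
have b0 : r4@_(mn4 0 0 0 0) = 0.
  by have := coef 1%N 2%N 1%N; do 6!rewrite ?coefE /=; rewrite !red3.
have b1 : r4@_(mn4 1 0 0 0) = 0.
  by apply: half; have := coef 3%N 1%N 1%N; do 6!rewrite ?coefE /=; rewrite !red3 mulr2n.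
have b2 : r4@_(mn4 0 1 0 0) = 0.
  by have := coef 1%N 3%N 1%N; do 6!rewrite ?coefE /=; rewrite !red3.
have b3 : r4@_(mn4 0 0 1 0) = 0.
  by have := coef 1%N 1%N 3%N; do 6!rewrite ?coefE /=; rewrite !red3.
have [<- <- <- <-] := mn4U; move=> m; rewrite !inE => /or4P[] /eqP->; split=> //.
- by have := coef 4%N 0%N 0%N; do 6!rewrite ?coefE /=; rewrite !red3.
- by have := coef 0%N 4%N 0%N; do 6!rewrite ?coefE /=; rewrite !red3.
- by have := coef 0%N 0%N 4%N; do 6!rewrite ?coefE /=; rewrite !red3.
- by have := coef 5%N 0%N 0%N; do 6!rewrite ?coefE /=; rewrite !red3.
- by have := coef 1%N 4%N 0%N; do 6!rewrite ?coefE /=; rewrite !red3.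
- by have := coef 1%N 0%N 4%N; do 6!rewrite ?coefE /=; rewrite !red3.
- by have := coef 4%N 1%N 0%N; do 6!rewrite ?coefE /=; rewrite !red3.
- by have := coef 0%N 5%N 0%N; do 6!rewrite ?coefE /=; rewrite !red3.
- by have := coef 0%N 1%N 4%N; do 6!rewrite ?coefE /=; rewrite !red3.
- by have := coef 4%N 0%N 1%N; do 6!rewrite ?coefE /=; rewrite !red3.
- by have := coef 0%N 4%N 1%N; do 6!rewrite ?coefE /=; rewrite !red3.
- by have := coef 0%N 0%N 5%N; do 6!rewrite ?coefE /=; rewrite !red3.
Qed.

Lemma ord5_sum (T : nmodType) (F : 'I_5 -> T) : \sum_i F i = F 0 + F 1 + F 2 + F 3 + F 4.
Proof.
rewrite !big_ord_recr big_ord0 /= add0r.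
by congr (F _ + F _ + F _ + F _ + F _); apply: val_inj.
Qed.

Definition cubic_sum_gens (K : fieldType) : seq {mpoly K[4]} :=
  let w := 'X_0 in let x := 'X_1 in let y := 'X_2 in
  [:: w ^+ 4; x ^+ 4; y ^+ 4; (w + x + y) ^+ 4; w * x * y * (w + (w + x + y))].

Lemma cubic_sum_syzygyP (K : fieldType) (r : 'I_5 -> {mpoly K[4]}) :
  (2 : K) != 0 -> (5 : K) != 0 ->
  \sum_(i < 5) r i * (cubic_sum_gens K)`_i = 0 ->
  forall i m, m \in [:: 0%MM; U_(0%R)%MM; U_(1%R)%MM; U_(2%R)%MM] -> (r i)@_m = 0.
Proof.
move=> two0 five0; rewrite ord5_sum => rel i m mlow.
suff [m0 m1 m2 m3 m4] : [/\ (r 0)@_m = 0, (r 1)@_m = 0, (r 2)@_m = 0, (r 3)@_m = 0 &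
    (r 4)@_m = 0].
  case: i => -[|[|[|[|[|//]]]]] ilt; [rewrite -[RHS]m0|rewrite -[RHS]m1|
    rewrite -[RHS]m2|rewrite -[RHS]m3|rewrite -[RHS]m4]; congr (r _)@__; exact: val_inj.
apply: cubic_sum_syzygy mlow => //; rewrite -[RHS]rel.
move: (r 0) (r 1) (r 2) (r 3) (r 4) => r0 r1 r2 r3 r4.
by rewrite [r0 * _]mulrC [r1 * _]mulrC [r2 * _]mulrC [r3 * _]mulrC [r4 * _]mulrC.
Qed.

Lemma lefschetz_form_inj (K : fieldType) (d : nat) (p : {mpoly K[4]}) :
  2%N \notin [pchar K] -> 5%N \notin [pchar K] -> (d <= 4)%N -> p \is d.-homog ->
  lefschetz_form K * p \in J K -> p \in J K.
Proof.
move=> char2 char5 d4 pd /mem_JP[c0 c0E].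
have two0 : (2 : K) != 0 by move: char2; rewrite inE.
have five0 : (5 : K) != 0 by move: char5; rewrite inE.
(* The cofactors become homogeneous of degree [d - 3], at most 1, and vanish for [d < 3]. *)
pose c i := if (4 <= d.+1)%N then pihomog mdeg (d.+1 - 4) (c0 i) else 0.
have {c0E} cE : lefschetz_form K * p = \sum_(i < 5) c i * (J_gens K)`_i.
  rewrite -pihomog_J_gens -c0E pihomog_dE //.
  exact: dhomogM (lefschetz_form_homog K) pd.
have cL i : c i = ((c i)@_0%MM)%:MP + \sum_(j < 4) (c i)@_U_(j) *: 'X_j.
  rewrite /c; case: ifP => [_|_]; first by apply: homog_le1E (pihomogP _ _ _); lia.
  by rewrite mcoeff0 mpolyC0 add0r big1 // => j _; rewrite mcoeff0 scale0r.
pose s : {mpoly K[4]} := 'X_0 + 'X_1 + 'X_2.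
(* Substituting [w + x + y] for [z] realizes reduction modulo [L] inside the same polynomial
   ring. *)
pose t := [tuple 'X_0; 'X_1; 'X_2; s].
have tX :
    ('X_0 \mPo t = 'X_0) * ('X_1 \mPo t = 'X_1) * ('X_2 \mPo t = 'X_2) * ('X_3 \mPo t = s).
  by rewrite !comp_mpolyXU.
have Lt : lefschetz_form K \mPo t = 0.
  by rewrite /lefschetz_form comp_mpolyB !comp_mpolyD !tX subrr.
have ct i : c i \mPo t = ((c i)@_0%MM)%:MP + ((c i)@_U_(0) + (c i)@_U_(3)) *: 'X_0
    + ((c i)@_U_(1) + (c i)@_U_(3)) *: 'X_1 + ((c i)@_U_(2) + (c i)@_U_(3)) *: 'X_2.
  have affine (R : comNzRingType) (k a0 a1 a2 a3 w x y : R) :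
      k + (a0 * w + a1 * x + a2 * y + a3 * (w + x + y)) =
      k + (a0 + a3) * w + (a1 + a3) * x + (a2 + a3) * y by ring.
  rewrite {1}cL ord4_sum !comp_mpolyD comp_mpolyC !comp_mpolyZ !tX -!mul_mpolyC !mpolyCD.
  exact: affine.
have gt (i : 'I_5) : (J_gens K)`_i \mPo t = (cubic_sum_gens K)`_i.
  by case: i => -[|[|[|[|[|//]]]]] ilt; rewrite /= ?rmorphXn ?rmorphM ?rmorphD /= ?tX //
    !rmorphM /= !tX.
have ct0 : forall i m, m \in [:: 0%MM; U_(0%R)%MM; U_(1%R)%MM; U_(2%R)%MM] ->
    (c i \mPo t)@_m = 0.
  apply: cubic_sum_syzygyP => //.
  transitivity ((lefschetz_form K * p) \mPo t); last by rewrite rmorphM /= Lt mul0r.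
  by rewrite cE rmorph_sum; apply: eq_bigr => i _; rewrite rmorphM /= gt.
have Xc (i j : 'I_4) : ('X_i : {mpoly K[4]})@_U_(j) = (i == j)%:R by exact: mcoeffXU.
have X0 (i : 'I_4) : ('X_i : {mpoly K[4]})@_0%MM = 0 by rewrite mcoeffX mnm1_eq0.
have ctE m i : (c i \mPo t)@_m = (c i)@_0%MM * (m == 0%MM)%:R
  + ((c i)@_U_(0) + (c i)@_U_(3)) * ('X_0 : {mpoly K[4]})@_m
  + ((c i)@_U_(1) + (c i)@_U_(3)) * ('X_1 : {mpoly K[4]})@_m
  + ((c i)@_U_(2) + (c i)@_U_(3)) * ('X_2 : {mpoly K[4]})@_m.
  by rewrite ct !mcoeffD mcoeffC !mcoeffZ.
(* The substituted cofactor has zero low coefficients: the constant term of [c i] vanishes and its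
   coefficients at [w], [x], [y] are opposite to that at [z], so [c i] is a scalar multiple of
   [L]. *)
have cLE i : c i = lefschetz_form K * (- (c i)@_U_(3))%:MP.
  have neg a : a + (c i)@_U_(3) = 0 -> a = - (c i)@_U_(3).
    by move/eqP; rewrite addr_eq0 => /eqP.
  have := ct0 i 0%MM; rewrite !inE eqxx ctE !X0 !mulr0 !addr0 eqxx mulr1 => /(_ isT) k0.
  have := ct0 i U_(0%R)%MM; rewrite !inE eqxx orbT ctE !Xc mnm1_eq0 /=.
  rewrite !mulr0 !addr0 mulr1 add0r => /(_ isT)/neg k1.
  have := ct0 i U_(1%R)%MM; rewrite !inE eqxx !orbT ctE !Xc mnm1_eq0 /=.
  rewrite !mulr0 !addr0 mulr1 add0r => /(_ isT)/neg k2.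
  have := ct0 i U_(2%R)%MM; rewrite !inE eqxx !orbT ctE !Xc mnm1_eq0 /=.
  rewrite !mulr0 !addr0 mulr1 add0r => /(_ isT)/neg k3.
  rewrite {1}cL ord4_sum k0 mpolyC0 add0r k1 k2 k3 !scaleNr -!mul_mpolyC.
  rewrite mpolyCN mulrN [lefschetz_form K * _]mulrC /lefschetz_form.
  by rewrite mulrBr !mulrDr !opprD opprK.
have L0 : lefschetz_form K != 0.
  apply/eqP => /(congr1 (mcoeff U_(0))); rewrite mcoeff0 !(mcoeffB, mcoeffD) !Xc /= => /eqP.
  by rewrite !addr0 subr0 oner_eq0.
(* The factor [L], common to all cofactors, is cancelled in the polynomial ring, which is a
   domain. *)
have -> : p = \sum_(i < 5) (- (c i)@_U_(3))%:MP * (J_gens K)`_i.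
  apply: (mulfI L0); rewrite cE mulr_sumr; apply: eq_bigr => i _.
  by rewrite {1}cLE mulrA.
by apply/mem_JP; exists (fun i => (- (c i)@_U_(3))%:MP).
Qed.

Theorem proposition5p3 (K : fieldType) :
  weak_lefschetz (J K) <-> 2%N \notin [pchar K]%R /\ 5%N \notin [pchar K]%R.
Proof.
split=> [|[char2 char5]]; first exact: weak_lefschetz_J_pchar.
apply/weak_lefschetzP; exists (lefschetz_form K); first exact: lefschetz_form_homog.
move=> d; have [d4|d5] := leqP d 4; [left|right] => p pd.
  exact: lefschetz_form_inj pd.
exact: lefschetz_form_surj.
Qed.
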